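(* Let $(\bar Q\subseteq Q,\ast)$ be a Hopf digraph-quiver triple on a finite group $G$. The associated quiver calculus $\Omega^1=kQ_1$, $\mathrm{d}=[\theta,\ ]$ on $k(G)$ is bicovariant, and every generalised bicovariant differential calculus on $k(G)$ is isomorphic to one of this form. Its structure is inner with $$(x\xrightarrow{(i)}y).f=f(y)\,x\xrightarrow{(i)}y,\qquad f.(x\xrightarrow{(i)}y)=f(x)\,x\xrightarrow{(i)}y,\qquad\theta=\sum_{a\in\bar C}\sum_{x\in G}x\xrightarrow{(1)}xa,$$ $$\Delta_L(x\xrightarrow{(i)}xg)=\sum_{h\in G}\delta_h\otimes(h^{-1}x\xrightarrow{(i)}h^{-1}xg),\qquad\Delta_R(x\xrightarrow{(i)}xg)=\sum_{h\in G}h\ast(x\xrightarrow{(i)}xg)\otimes\delta_h.$$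
   Context: $k$ is a field of characteristic not $2$, $k(G)$ is the Hopf algebra of functions on $G$ with delta functions $\delta_h$, and calculi are finite-dimensional. A generalised first order differential calculus on an algebra $A$ is an $A$-bimodule $\Omega^1$ with a linear map $\mathrm{d}:A\to\Omega^1$ obeying the Leibniz rule (no surjectivity of $a\otimes b\mapsto a\,\mathrm{d}b$ required). It is inner if $\mathrm{d}a=[\theta,a]=\theta a-a\theta$ for some $\theta\in\Omega^1$. For a Hopf algebra $A$ it is bicovariant if equipped with commuting left and right coactions $\Delta_L,\Delta_R$ of $A$ on $\Omega^1$ that are bimodule maps and such that $\mathrm{d}$ is a bicomodule map. Isomorphisms are bimodule and bicomodule isomorphisms commuting with $\mathrm{d}$. For a quiver $Q$ with vertex set $G$, $kQ_1$ is the span of its arrows and ${}^xkQ_1{}^y$ the span of the arrows from $x$ to $y$. A Cayley digraph $\bar Q=\bar Q(G,\bar C)$ has vertex set $G$ and a single arrow $x\to y$ iff $x^{-1}y\in\bar C$, where $\bar C\subseteq G\setminus\{e\}$ is stable under conjugation; its canonical commuting left and right actions are $h\ast(x\to y)=(xh^{-1}\to yh^{-1})$ and $(x\to y)\ast h=(h^{-1}x\to h^{-1}y)$. A coloured Hopf quiver $Q=Q(G,R)$ has vertex set $G$ and, given numbers $R_C\in\mathbb{N}_0$ for each conjugacy class $C$ of $G$, precisely $R_C$ arrows $x\xrightarrow{(i)}y$, labelled $i=1,\dots,R_C$, whenever $x^{-1}y\in C$; its canonical right action is $(x\xrightarrow{(i)}y)\ast h=h^{-1}x\xrightarrow{(i)}h^{-1}y$.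 A Hopf digraph-quiver triple $(\bar Q\subseteq Q,\ast)$ consists of a coloured Hopf quiver $Q=Q(G,R)$ containing a Cayley digraph $\bar Q=\bar Q(G,\bar C)$ (same vertex set $G$) whose arrows are all of colour $1$, i.e. $\bar Q$ consists of the arrows $x\xrightarrow{(1)}xa$, $a\in\bar C$, together with a left action $\ast$ of $G$ on $kQ_1$ such that: (1) $h\ast{}^xkQ_1{}^y={}^{xh^{-1}}kQ_1{}^{yh^{-1}}$ for all $h,x,y\in G$; (2) $\ast$ restricts on $\bar Q_1$ to the canonical left action; (3) $\ast$ commutes with the canonical right action on $kQ_1$. *)

(* Defs.v *)
From HB Require Import structures.
From mathcomp Require Import all_boot all_fingroup all_algebra.

Set Implicit Arguments.
Unset Strict Implicit.
Unset Printing Implicit Defensive.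

Import GRing.Theory.
Local Open Scope ring_scope.

(* The Hopf algebra k(G) of a finite group; its product is the pointwise
   product that MathComp puts on {ffun gT -> k^o}, where k^o is k as a module
   over itself. *)
Section FunctionHopfAlgebra.
Variables (k : fieldType) (gT : finGroupType).

Definition fun_alg := {ffun gT -> k^o}.

Definition delta (h : gT) : fun_alg := [ffun x => (x == h)%:R].

(* k(G) (x) V and V (x) k(G) are both realised as {ffun gT -> V}: the function F
   stands for \sum_h delta_h (x) F h, resp. \sum_h F h (x) delta_h
   (ltens_sum and rtens_sum below). *)
Definition ltens (V : lmodType k) (f : fun_alg) (v : V) : {ffun gT -> V} :=
  [ffun h => f h *: v].
Definition rtens (V : lmodType k) (v : V) (f : fun_alg) : {ffun gT -> V} :=
  [ffun h => f h *: v].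

(* Delta f = f (_ * _); with the convention above,
   Delta f = \sum_g delta_g (x) comult f g. *)
Definition comult (f : fun_alg) : {ffun gT -> fun_alg} :=
  [ffun g => [ffun h => f (g * h)%g]].
Definition counit (f : fun_alg) : k := f 1%g.

Lemma ltens_sum (V : lmodType k) (F : {ffun gT -> V}) :
  F = \sum_h ltens (delta h) (F h).
Proof.
apply/ffunP => g; rewrite sum_ffunE (bigD1 g) //= big1 => [|h /negPf hg].
  by rewrite !ffunE eqxx scale1r addr0.
by rewrite !ffunE eq_sym hg scale0r.
Qed.

Lemma rtens_sum (V : lmodType k) (F : {ffun gT -> V}) :
  F = \sum_h rtens (F h) (delta h).
Proof. exact: ltens_sum. Qed.

End FunctionHopfAlgebra.

Arguments delta k {gT} h.

Section Calculi.
Variables (k : fieldType) (gT : finGroupType).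
Local Notation A := (fun_alg k gT).

Record calculus_data (V : vectType k) := CalculusData {
  lmul : A -> V -> V;
  rmul : V -> A -> V;
  differential : A -> V;
  coactL : V -> {ffun gT -> V};  (* V -> k(G) (x) V *)
  coactR : V -> {ffun gT -> V}   (* V -> V (x) k(G) *)
}.

Definition is_bimodule (V : vectType k) (lm : A -> V -> V) (rm : V -> A -> V) :
    Prop :=
  [/\ (forall a, linear (lm a)) /\ (forall v, linear (lm^~ v : A -> V)),
      (forall v, linear (rm v)) /\ (forall a, linear (rm^~ a : V -> V)),
      (forall v, lm 1 v = v) /\ (forall a b v, lm (a * b) v = lm a (lm b v)),
      (forall v, rm v 1 = v) /\ (forall a b v, rm v (a * b) = rm (rm v a) b) &
      forall a b v, rm (lm a v) b = lm a (rm v b)].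

(* No condition that V be spanned by the elements a (d b). *)
Definition is_gen_calculus (V : vectType k) (D : calculus_data V) : Prop :=
  [/\ is_bimodule (lmul D) (rmul D),
      linear (differential D) &
      forall a b, differential D (a * b) = rmul D (differential D a) b + lmul D a (differential D b)].

Definition is_inner_by (V : vectType k) (D : calculus_data V) (theta : V) :
    Prop :=
  forall a, differential D a = rmul D theta a - lmul D a theta.

(* Coassociativity in the coordinates of delta_g (x) delta_h (x) V:
   (id (x) rho) rho = (Delta (x) id) rho. *)
Definition is_left_coaction (V : vectType k) (rho : V -> {ffun gT -> V}) :
    Prop :=
  [/\ linear rho,
      forall v g h,
        rho (rho v g) h = \sum_x comult (delta k x) g h *: rho v x &
      forall v, \sum_x counit (delta k x) *: rho v x = v].

(* Same in the coordinates of V (x) delta_g (x) delta_h: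
   (rho (x) id) rho = (id (x) Delta) rho. *)
Definition is_right_coaction (V : vectType k) (rho : V -> {ffun gT -> V}) :
    Prop :=
  [/\ linear rho,
      forall v g h,
        rho (rho v h) g = \sum_x comult (delta k x) g h *: rho v x &
      forall v, \sum_x counit (delta k x) *: rho v x = v].

(* (Delta_L (x) id) Delta_R = (id (x) Delta_R) Delta_L in the coordinates of
   delta_g (x) V (x) delta_h. *)
Definition coactions_commute (V : vectType k) (rL rR : V -> {ffun gT -> V}) :
    Prop :=
  forall v g h, rL (rR v h) g = rR (rL v g) h.

(* k(G) acts on k(G) (x) V and on V (x) k(G) through Delta, e.g.
   a . (b (x) v) = a_(1) b (x) a_(2) . v. *)
Definition lmul_tensL (V : vectType k) (lm : A -> V -> V) (a : A)
    (F : {ffun gT -> V}) : {ffun gT -> V} :=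
  \sum_g \sum_h ltens (delta k g * delta k h) (lm (comult a g) (F h)).
Definition rmul_tensL (V : vectType k) (rm : V -> A -> V)
    (F : {ffun gT -> V}) (a : A) : {ffun gT -> V} :=
  \sum_g \sum_h ltens (delta k h * delta k g) (rm (F h) (comult a g)).
Definition lmul_tensR (V : vectType k) (lm : A -> V -> V) (a : A)
    (F : {ffun gT -> V}) : {ffun gT -> V} :=
  \sum_g \sum_h rtens (lm (delta k g) (F h)) (comult a g * delta k h).
Definition rmul_tensR (V : vectType k) (rm : V -> A -> V)
    (F : {ffun gT -> V}) (a : A) : {ffun gT -> V} :=
  \sum_g \sum_h rtens (rm (F h) (delta k g)) (delta k h * comult a g).

Definition is_bicovariant (V : vectType k) (D : calculus_data V) : Prop :=
  [/\ is_left_coaction (coactL D) /\ is_right_coaction (coactR D),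
      coactions_commute (coactL D) (coactR D),
      (forall a v, coactL D (lmul D a v) = lmul_tensL (lmul D) a (coactL D v))
      /\ (forall v a, coactL D (rmul D v a) = rmul_tensL (rmul D) (coactL D v) a),
      (forall a v, coactR D (lmul D a v) = lmul_tensR (lmul D) a (coactR D v))
      /\ (forall v a, coactR D (rmul D v a) = rmul_tensR (rmul D) (coactR D v) a) &
      (forall a, coactL D (differential D a) =
                 \sum_g ltens (delta k g) (differential D (comult a g)))
      /\ (forall a, coactR D (differential D a) =
                    \sum_g rtens (differential D (delta k g)) (comult a g))].

Definition is_gen_bicovariant_calculus (V : vectType k) (D : calculus_data V) :
    Prop :=
  is_gen_calculus D /\ is_bicovariant D.

Definition calculus_iso (V W : vectType k) (D : calculus_data V)
    (E : calculus_data W) : Prop :=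
  exists2 phi : {linear V -> W}, bijective phi &
    [/\ (forall a v, phi (lmul D a v) = lmul E a (phi v)),
        (forall v a, phi (rmul D v a) = rmul E (phi v) a),
        (forall a, phi (differential D a) = differential E a),
        (forall v, coactL E (phi v) = [ffun h => phi (coactL D v h)]) &
        (forall v, coactR E (phi v) = [ffun h => phi (coactR D v h)])].

End Calculi.

Record quiver (V : finType) := Quiver {
  arrow : finType;
  source : arrow -> V;
  target : arrow -> V
}.

Section PathSpace.
Variables (k : fieldType) (V : finType) (Q : quiver V).

(* kQ_1, with basis the arrows. *)
Definition arrow_space : vectType k := {ffun arrow Q -> k^o}.

Definition arrow_vec (al : arrow Q) : arrow_space := [ffun be => (be == al)%:R].

(* x_kQ_1^y *)
Definition arrow_span (x y : V) : {vspace arrow_space} :=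
  (<<[seq arrow_vec al | al <- enum (arrow Q) &
        (source al == x) && (target al == y)]>>)%VS.

Definition lin_ext (W : lmodType k) (phi : arrow Q -> W) (v : arrow_space) : W :=
  \sum_al v al *: phi al.

End PathSpace.

Arguments arrow_vec k {V Q} al.

Section HopfQuivers.
Variable gT : finGroupType.

(* An arrow x -> y is recorded by x and its step a = x^-1 * y, so that colours
   need no transport along (h^-1 x)^-1 (h^-1 y) = x^-1 y.  Colours are counted
   from 0 instead of 1.  Only the values of R on conjugacy classes matter. *)
Definition hopf_quiver (R : {set gT} -> nat) : quiver gT :=
  @Quiver gT (gT * {a : gT & 'I_(R (a ^: [set: gT])%g)})%type
    (fun al => al.1) (fun al => (al.1 * tag al.2)%g).

(* The arrow x --(i+1)--> x a. *)
Definition hopf_arrow (R : {set gT} -> nat) (x a : gT)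
    (i : 'I_(R (a ^: [set: gT])%g)) : arrow (hopf_quiver R) :=
  (x, Tagged (fun a => 'I_(R (a ^: [set: gT])%g)) i).

Lemma card_hopf_arrows (R : {set gT} -> nat) (x y : gT) :
  #|[set al : arrow (hopf_quiver R) | (source al == x) && (target al == y)]|
    = R ((x^-1 * y) ^: [set: gT])%g.
Proof.
pose f (i : 'I_(R ((x^-1 * y) ^: [set: gT])%g)) : arrow (hopf_quiver R) :=
  hopf_arrow x i.
have f_inj : injective f by move=> i j [/eqP]; rewrite eq_Tagged => /eqP.
rewrite -[RHS]card_ord -(card_imset predT f_inj); apply: eq_card => al.
rewrite inE; apply/andP/imsetP => [[]|[i _ ->]]; last first.
  by rewrite /= eqxx mulKVg.
case: al => z [a i] /= /eqP zx; subst z => /eqP xay.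
have e : a = (x^-1 * y)%g by rewrite -xay mulKg.
by subst a; exists i.
Qed.

Definition hopf_ract (R : {set gT} -> nat) (al : arrow (hopf_quiver R))
    (h : gT) : arrow (hopf_quiver R) :=
  ((h^-1 * al.1)%g, al.2).

(* Again x -> x a is recorded by x and a. *)
Definition cayley_digraph (C : {set gT}) : quiver gT :=
  @Quiver gT (gT * {a : gT | a \in C})%type
    (fun al => al.1) (fun al => (al.1 * val al.2)%g).

Definition conj_stable (C : {set gT}) : Prop :=
  forall h a : gT, a \in C -> (h * a * h^-1)%g \in C.

(* h * (x -> x a) = (x h^-1 -> x a h^-1), whose step is h a h^-1. *)
Definition cayley_lact (C : {set gT}) (CJ : conj_stable C) (h : gT)
    (al : arrow (cayley_digraph C)) : arrow (cayley_digraph C) :=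
  ((al.1 * h^-1)%g, exist _ (h * val al.2 * h^-1)%g (CJ h _ (valP al.2))).

Lemma source_cayley_lact (C : {set gT}) (CJ : conj_stable C) h al :
  source (cayley_lact CJ h al) = (source al * h^-1)%g.
Proof. by []. Qed.

Lemma target_cayley_lact (C : {set gT}) (CJ : conj_stable C) h al :
  target (cayley_lact CJ h al) = (target al * h^-1)%g.
Proof. by rewrite /= !mulgA mulgKV. Qed.

(* Inclusion of the Cayley digraph as arrows of the first colour. *)
Definition cayley_incl (R : {set gT} -> nat) (C : {set gT})
    (CR : forall a, a \in C -> (0 < R (a ^: [set: gT])%g)%N)
    (al : arrow (cayley_digraph C)) : arrow (hopf_quiver R) :=
  hopf_arrow al.1 (Ordinal (CR _ (valP al.2))).

End HopfQuivers.

Section Triples.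
Variables (k : fieldType) (gT : finGroupType).

(* mult C is R_C and steps is the set \bar C. *)
Record hopf_triple := HopfTriple {
  mult : {set gT} -> nat;
  steps : {set gT};
  steps1 : 1%g \notin steps;
  stepsJ : conj_stable steps;
  steps_mult : forall a, a \in steps -> (0 < mult (a ^: [set: gT])%g)%N;
  lact : gT -> 'End(arrow_space k (hopf_quiver mult));
  lact1 : forall v, lact 1%g v = v;
  lactM : forall g h v, lact (g * h)%g v = lact g (lact h v);
  lact_span : forall h x y,
    (lact h @: arrow_span k (hopf_quiver mult) x y)%VS =
      arrow_span k (hopf_quiver mult) (x * h^-1)%g (y * h^-1)%g;
  lact_cayley : forall h (al : arrow (cayley_digraph steps)),
    lact h (arrow_vec k (cayley_incl steps_mult al)) =
      arrow_vec k (cayley_incl steps_mult (cayley_lact stepsJ h al));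
  lact_ract : forall g h v,
    lact g (lin_ext (fun al => arrow_vec k (hopf_ract al h)) v) =
      lin_ext (fun al => arrow_vec k (hopf_ract al h)) (lact g v)
}.

Variable T : hopf_triple.

Definition triple_quiver : quiver gT := hopf_quiver (mult T).
Definition triple_space : vectType k := arrow_space k triple_quiver.

(* The basis vector x --(i+1)--> x a of kQ_1. *)
Definition avec (x a : gT) (i : 'I_(mult T (a ^: [set: gT])%g)) : triple_space :=
  arrow_vec k (hopf_arrow x i).

(* The basis vector x --(1)--> x a, a in the Cayley digraph. *)
Definition cvec (x : gT) (a : {a : gT | a \in steps T}) : triple_space :=
  arrow_vec k (cayley_incl (@steps_mult T) (x, a)).

Definition quiver_theta : triple_space :=
  \sum_(a : {a : gT | a \in steps T}) \sum_(x : gT) cvec x a.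

Definition quiver_lmul (f : fun_alg k gT) : triple_space -> triple_space :=
  lin_ext (fun al : arrow triple_quiver => f (source al) *: arrow_vec k al).

Definition quiver_rmul (v : triple_space) (f : fun_alg k gT) : triple_space :=
  lin_ext (fun al : arrow triple_quiver => f (target al) *: arrow_vec k al) v.

Definition quiver_calculus : calculus_data gT triple_space := {|
  lmul := quiver_lmul;
  rmul := quiver_rmul;
  differential := fun f => quiver_rmul quiver_theta f - quiver_lmul f quiver_theta;
  coactL := lin_ext (fun al : arrow triple_quiver =>
    \sum_h ltens (delta k h) (arrow_vec k (hopf_ract al h) : triple_space));
  coactR := lin_ext (fun al : arrow triple_quiver =>
    \sum_h rtens (lact T h (arrow_vec k al)) (delta k h))
|}.

End Triples.

Arguments avec {k gT} T x {a} i.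
Arguments cvec {k gT} T x a.

(* Main.v *)
(** Evaluating the coactions at group elements turns them into commuting left and
    right actions of [G], and a bicovariant calculus into a [k(G)]-bimodule graded
    by the corners [delta_x V delta_y], which these actions permute.  Since
    [k(G)] is separable, [d] is inner, by the bi-invariant element
    [theta = \sum_y (d delta_y) delta_y], whose diagonal corners vanish.  The
    Cayley digraph consists of the steps [a] for which the component of [theta]
    in [delta_e V delta_a] is nonzero.  A basis of each [delta_e V delta_a],
    starting with that component if it is nonzero, is transported by left
    translation to all [delta_x V delta_xa]: the basis vectors are the arrows, and
    the action obtained from [Delta_R] is the left action of the triple. *)
From HB Require Import structures.
Require Import Defs.
From mathcomp Require Import all_boot all_fingroup all_algebra.

Set Implicit Arguments.
Unset Strict Implicit.
Unset Printing Implicit Defensive.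

Import GRing.Theory.
Local Open Scope ring_scope.

(** * Linearity given as a hypothesis *)

(** The data of a calculus are bare functions with linearity assumed separately, so the linear
    structure is packed on the spot. *)
Lemma linfunE (k : fieldType) (U W : vectType k) (f : U -> W) :
  linear f -> linfun f =1 f.
Proof.
move=> f_lin u; pose F : {linear U -> W} :=
  HB.pack f (GRing.isLinear.Build k U W _ f f_lin).
exact: (lfunE F).
Qed.

Section LinearSums.
Variables (k : fieldType) (U W : lmodType k) (f : U -> W).
Hypothesis f_lin : linear f.

Let F : {linear U -> W} := HB.pack f (GRing.isLinear.Build k U W _ f f_lin).

Lemma linear_sumf (I : finType) (P : pred I) (u : I -> U) :
  f (\sum_(i | P i) u i) = \sum_(i | P i) f (u i).
Proof. exact: (linear_sum F). Qed.

Lemma linear_scalef c u : f (c *: u) = c *: f u.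
Proof. exact: (linearZZ F). Qed.

Lemma linear_addf u v : f (u + v) = f u + f v.
Proof. exact: (linearD F). Qed.

Lemma linear_subf u v : f (u - v) = f u - f v.
Proof. exact: (linearB F). Qed.

Lemma linear_zerof : f 0 = 0.
Proof. exact: (linear0 F). Qed.

End LinearSums.

(** * Coordinates on $k(G)$ and on its tensor products *)

Section FunAlg.
Variables (k : fieldType) (gT : finGroupType).
Local Notation A := (fun_alg k gT).

(** Coefficients of the coproduct in its other leg: $\Delta a=\sum_t$ [rtranslate a t]
    $\otimes\,\delta_t$. *)
Definition rtranslate (a : A) (t : gT) : A := [ffun g => a (g * t)%g].

Lemma fun_alg_sum (a : A) : a = \sum_g a g *: delta k g.
Proof.
apply/ffunP => h; rewrite sum_ffunE (bigD1 h) //= big1 ?addr0 => [|g /negPf gh].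
  by rewrite !ffunE eqxx [RHS]mulr1.
by rewrite !ffunE eq_sym gh scaler0.
Qed.

Lemma delta_mul (a : A) g : a * delta k g = a g *: delta k g.
Proof.
apply/ffunP => h; rewrite !ffunE; case: eqP => [->|] //=.
by rewrite scaler0 mulr0.
Qed.

Lemma mul_delta (a : A) g : delta k g * a = a g *: delta k g.
Proof.
apply/ffunP => h; rewrite !ffunE; case: eqP => [->|] //=.
  by rewrite mul1r [RHS]mulr1.
by rewrite scaler0 mul0r.
Qed.

Lemma delta_sum1 : \sum_(g : gT) delta k g = 1 :> A.
Proof. by rewrite [RHS]fun_alg_sum; apply: eq_bigr => g _; rewrite ffunE scale1r. Qed.

Lemma comult_delta (g x : gT) : comult (delta k x) g = delta k (g^-1 * x)%g.
Proof. by apply/ffunP => h; rewrite !ffunE (canF_eq (mulKg g)). Qed.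

Lemma rtranslate_delta (t x : gT) : rtranslate (delta k x) t = delta k (x * t^-1)%g.
Proof. by apply/ffunP => h; rewrite !ffunE (canF_eq (mulgK t)). Qed.

(** Only $x=gh$ contributes, which turns coassociativity into the composition law of a group
    action. *)
Lemma comult_sum_delta (g h : gT) (V : lmodType k) (rho : {ffun gT -> V}) :
  \sum_x comult (delta k x) g h *: rho x = rho (g * h)%g.
Proof.
rewrite (bigD1 (g * h)%g) //= big1 => [|x /negPf xgh].
  by rewrite !ffunE eqxx scale1r addr0.
by rewrite !ffunE eq_sym xgh scale0r.
Qed.

Lemma counit_sum_delta (V : lmodType k) (rho : {ffun gT -> V}) :
  \sum_x counit (delta k x) *: rho x = rho 1%g.
Proof.
rewrite (bigD1 1%g) //= big1 => [|x /negPf x1].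
  by rewrite /counit !ffunE eqxx scale1r addr0.
by rewrite /counit !ffunE eq_sym x1 scale0r.
Qed.

Section Tensors.
Variable V : vectType k.

Lemma sum_ffunvE (I : finType) (P : pred I) (F : I -> {ffun gT -> V}) t :
  (\sum_(i | P i) F i) t = \sum_(i | P i) F i t.
Proof. exact: sum_ffunE. Qed.

Lemma sum_ltens_delta (F : gT -> V) t : (\sum_g ltens (delta k g) (F g)) t = F t.
Proof.
rewrite sum_ffunvE (bigD1 t) //= big1 => [|g /negPf gt].
  by rewrite !ffunE eqxx scale1r addr0.
by rewrite !ffunE eq_sym gt scale0r.
Qed.

(** The product $\delta_g\delta_h$ evaluated at $t$ leaves only the term $g=h=t$. *)
Lemma lmul_tensLE lm (a : A) (F : {ffun gT -> V}) t :
  lmul_tensL lm a F t = lm (comult a t) (F t).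
Proof.
rewrite -[RHS](sum_ltens_delta (fun h => lm (comult a t) (F h))).
rewrite /lmul_tensL !sum_ffunvE (bigD1 t) //= [X in _ + X]big1 => [|g /negPf gt].
  rewrite addr0 sum_ffunvE; apply: eq_bigr => h _.
  by rewrite !ffunE eqxx mul1r.
rewrite sum_ffunvE big1 // => h _.
by rewrite !ffunE [t == g]eq_sym gt mul0r scale0r.
Qed.

Lemma rmul_tensLE rm (a : A) (F : {ffun gT -> V}) t :
  rmul_tensL rm F a t = rm (F t) (comult a t).
Proof.
rewrite -(lmul_tensLE (fun a v => rm v a) a F t) /rmul_tensL /lmul_tensL !sum_ffunvE.
apply: eq_bigr => g _; rewrite !sum_ffunvE; apply: eq_bigr => h _.
by rewrite !ffunE mulrC.
Qed.

(** Here the acting leg is the one expanded in delta functions, so linearity of [lm] in the function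
    reassembles [rtranslate a t]. *)
Lemma lmul_tensRE lm (a : A) (F : {ffun gT -> V}) t :
    (forall v, linear (lm^~ v : A -> V)) ->
  lmul_tensR lm a F t = lm (rtranslate a t) (F t).
Proof.
move=> lm_lin; rewrite [rtranslate a t]fun_alg_sum (linear_sumf (lm_lin _)).
rewrite /lmul_tensR sum_ffunvE; apply: eq_bigr => g _; rewrite (linear_scalef (lm_lin _)).
rewrite -[RHS](sum_ltens_delta (fun h => rtranslate a t g *: lm (delta k g) (F h))).
rewrite !sum_ffunvE; apply: eq_bigr => h _; rewrite !ffunE.
by rewrite mulrC -scalerA.
Qed.

Lemma rmul_tensRE rm (a : A) (F : {ffun gT -> V}) t :
    (forall v, linear (rm v : A -> V)) ->
  rmul_tensR rm F a t = rm (F t) (rtranslate a t).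
Proof.
move=> rm_lin; rewrite -(lmul_tensRE (lm := fun a v => rm v a)) //.
rewrite /rmul_tensR /lmul_tensR !sum_ffunvE.
apply: eq_bigr => g _; rewrite !sum_ffunvE; apply: eq_bigr => h _.
by rewrite !ffunE mulrC.
Qed.

Lemma ffun_linear (rho : V -> {ffun gT -> V}) :
  linear rho <-> forall g, linear (rho^~ g).
Proof.
split=> rho_lin => [g c u v|c u v]; first by rewrite rho_lin !ffunE.
by apply/ffunP => g; rewrite rho_lin !ffunE.
Qed.

(** Stated for both sides at once: [tau] is the action on $k(G)$ that accompanies [rho], namely
    [comult] for [coactL] and [rtranslate] for [coactR]. *)
Definition is_equivariant (D : calculus_data gT V) (rho : gT -> V -> V)
    (tau : gT -> A -> A) : Prop :=
  [/\ forall g a v, rho g (lmul D a v) = lmul D (tau g a) (rho g v),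
      forall g v a, rho g (rmul D v a) = rmul D (rho g v) (tau g a) &
      forall g a, rho g (differential D a) = differential D (tau g a)].

(* The coefficients of the coactions are commuting actions of the group: a right
   one for [coactL], a left one for [coactR]. *)
Lemma bicovariantP (D : calculus_data gT V) : is_gen_calculus D ->
  is_bicovariant D <->
  [/\ [/\ forall g, linear (fun v => coactL D v g),
          forall v, coactL D v 1%g = v &
          forall v g h, coactL D (coactL D v g) h = coactL D v (g * h)%g],
      [/\ forall g, linear (fun v => coactR D v g),
          forall v, coactR D v 1%g = v &
          forall v g h, coactR D (coactR D v h) g = coactR D v (g * h)%g],
      forall v g h, coactL D (coactR D v h) g = coactR D (coactL D v g) h,
      is_equivariant D (fun g v => coactL D v g) (fun g a => comult a g) &
      is_equivariant D (fun g v => coactR D v g) (fun g a => rtranslate a g)].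
Proof.
move=> [[[_ lm_lin] [rm_lin _] _ _ _] d_lin _].
(* The clause relating [coactR] and [d] is expanded in the leg to which [d] applies; linearity of
   [d] resums it. *)
have dR a g : (\sum_h rtens (differential D (delta k h)) (comult a h)) g
    = differential D (rtranslate a g).
  rewrite [rtranslate a g]fun_alg_sum (linear_sumf d_lin) sum_ffunvE.
  by apply: eq_bigr => h _; rewrite (linear_scalef d_lin) !ffunE.
split.
  move=> [[[L_lin LM L1] [R_lin RM R1]] LR [Ll Lr] [Rl Rr] [Ld Rd]].
  split=> //; split.
  - exact/ffun_linear.
  - by move=> v; rewrite -[LHS]counit_sum_delta L1.
  - by move=> v g h; rewrite LM comult_sum_delta.
  - exact/ffun_linear.
  - by move=> v; rewrite -[LHS]counit_sum_delta R1.
  - by move=> v g h; rewrite RM comult_sum_delta.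
  - by move=> g a v; rewrite Ll lmul_tensLE.
  - by move=> g v a; rewrite Lr rmul_tensLE.
  - by move=> g a; rewrite Ld sum_ltens_delta.
  - by move=> g a v; rewrite Rl lmul_tensRE.
  - by move=> g v a; rewrite Rr rmul_tensRE.
  - by move=> g a; rewrite Rd dR.
move=> [[L_lin L1 LM] [R_lin R1 RM] LR [Ll Lr Ld] [Rl Rr Rd]].
split=> //; split.
- split=> [||v]; [exact/ffun_linear | | by rewrite counit_sum_delta].
  by move=> v g h; rewrite LM comult_sum_delta.
- split=> [||v]; [exact/ffun_linear | | by rewrite counit_sum_delta].
  by move=> v g h; rewrite RM comult_sum_delta.
- by move=> a v; apply/ffunP => g; rewrite lmul_tensLE Ll.
- by move=> v a; apply/ffunP => g; rewrite rmul_tensLE Lr.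
- by move=> a v; apply/ffunP => g; rewrite lmul_tensRE ?Rl.
- by move=> v a; apply/ffunP => g; rewrite rmul_tensRE ?Rr.
- by move=> a; apply/ffunP => g; rewrite sum_ltens_delta Ld.
- by move=> a; apply/ffunP => g; rewrite dR Rd.
Qed.

End Tensors.
End FunAlg.

(** * Supports and linear extensions in the path space *)

Section ArrowSpaces.
Variables (k : fieldType) (V : finType) (Q : quiver V).
Local Notation kQ := (arrow_space k Q).

Lemma arrow_vecE (al be : arrow Q) : arrow_vec k al be = (be == al)%:R.
Proof. by rewrite ffunE. Qed.

Lemma arrow_space_sum (v : kQ) : v = \sum_al v al *: arrow_vec k al.
Proof.
apply/ffunP => be; rewrite sum_ffunE (bigD1 be) //= big1 => [|al /negPf al_be].
  by rewrite !ffunE eqxx [RHS]addr0 [RHS]mulr1.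
by rewrite !ffunE eq_sym al_be scaler0.
Qed.

Lemma lin_ext_linear (W : lmodType k) (phi : arrow Q -> W) :
  linear (lin_ext phi : kQ -> W).
Proof.
move=> c u v; rewrite /lin_ext scaler_sumr -big_split; apply: eq_bigr => al _.
by rewrite !ffunE scalerDl scalerA.
Qed.

Lemma lin_ext_vec (W : lmodType k) (phi : arrow Q -> W) al :
  lin_ext phi (arrow_vec k al) = phi al.
Proof.
rewrite /lin_ext (bigD1 al) //= big1 => [|be /negPf be_al].
  by rewrite arrow_vecE eqxx scale1r addr0.
by rewrite arrow_vecE be_al scale0r.
Qed.

Lemma linear_eq_vec (W : lmodType k) (f g : kQ -> W) :
    linear f -> linear g ->
  (forall al, f (arrow_vec k al) = g (arrow_vec k al)) -> f =1 g.
Proof.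
move=> f_lin g_lin fg v; rewrite [v]arrow_space_sum.
rewrite (linear_sumf f_lin) (linear_sumf g_lin); apply: eq_bigr => al _.
by rewrite (linear_scalef f_lin) (linear_scalef g_lin) fg.
Qed.

(** Both module structures on $kQ_1$ are diagonal in the arrow basis, so the bimodule laws become
    identities between scalars at each arrow. *)
Lemma lin_ext_diag (phi : arrow Q -> k) (v : kQ) al :
  lin_ext (fun be => phi be *: (arrow_vec k be : kQ)) v al = phi al * v al.
Proof.
rewrite /lin_ext sum_ffunE (bigD1 al) //= big1 => [|be /negPf be_al].
  by rewrite !ffunE eqxx addr0 [RHS]mulrC [phi al *: _]mulr1.
by rewrite !ffunE eq_sym be_al !scaler0.
Qed.

(** The spanning vectors are part of the arrow basis, so their span is cut out by the vanishing of
    the remaining coordinates. *)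
Lemma arrow_spanP (v : kQ) x y :
  reflect (forall al, v al != 0 -> source al = x /\ target al = y)
    (v \in arrow_span k Q x y).
Proof.
apply: (iffP idP) => [|v_supp].
  rewrite /arrow_span span_def big_map big_filter big_enum_cond.
  case/memv_sumP=> u u_in -> al.
  have [/andP[/eqP-> /eqP->] //|al_xy] := boolP ((source al == x) && (target al == y)).
  case/eqP; rewrite sum_ffunE big1 // => be be_xy.
  have /vlineP[c ->] := u_in be be_xy; rewrite !ffunE.
  case: eqP => [al_be|_]; last by rewrite [LHS]mulr0.
  by case/andP: be_xy al_xy => _ be_xy; rewrite al_be be_xy.
rewrite [v]arrow_space_sum rpred_sum // => al _.
have [->|/v_supp[s_al t_al]] := eqVneq (v al) 0; first by rewrite scale0r mem0v.
by rewrite rpredZ // memv_span // map_f // mem_filter s_al t_al !eqxx mem_enum.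
Qed.

End ArrowSpaces.

(** * From a triple to a bicovariant calculus *)

Section QuiverCalculus.
Variables (k : fieldType) (gT : finGroupType) (T : hopf_triple k gT).
Local Notation A := (fun_alg k gT).
Local Notation Q := (triple_quiver T).
Local Notation kQ := (triple_space T).
Local Notation D := (quiver_calculus T).

Definition ract (h : gT) : kQ -> kQ :=
  lin_ext (fun al : arrow Q => arrow_vec k (hopf_ract al h) : kQ).

Lemma quiver_lmulE (f : A) (v : kQ) al : lmul D f v al = f (source al) * v al.
Proof. exact: lin_ext_diag. Qed.

Lemma quiver_rmulE (f : A) (v : kQ) al : rmul D v f al = f (target al) * v al.
Proof. exact: lin_ext_diag. Qed.

Lemma quiver_lmul_span (f : A) (v : kQ) x y :
  v \in arrow_span k Q x y -> lmul D f v = f x *: v.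
Proof.
move/arrow_spanP => v_xy; apply/ffunP => al; rewrite quiver_lmulE ffunE.
by have [->|/v_xy[<-]] := eqVneq (v al) 0; rewrite // scaler0 mulr0.
Qed.

Lemma quiver_rmul_span (f : A) (v : kQ) x y :
  v \in arrow_span k Q x y -> rmul D v f = f y *: v.
Proof.
move/arrow_spanP => v_xy; apply/ffunP => al; rewrite quiver_rmulE ffunE.
by have [->|/v_xy[_ <-]] := eqVneq (v al) 0; rewrite // scaler0 mulr0.
Qed.

Lemma arrow_vec_span (al : arrow Q) :
  arrow_vec k al \in arrow_span k Q (source al) (target al).
Proof.
apply/arrow_spanP => be; rewrite arrow_vecE; case: (be =P al) => [->|] //.
by rewrite eqxx.
Qed.

Lemma ract_span h x y v : v \in arrow_span k Q x y ->
  ract h v \in arrow_span k Q (h^-1 * x)%g (h^-1 * y)%g.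
Proof.
move/arrow_spanP => v_xy; apply: rpred_sum => al _.
have [->|/v_xy[<- <-]] := eqVneq (v al) 0; first by rewrite scale0r mem0v.
by rewrite rpredZ //= mulgA; apply: (arrow_vec_span (hopf_ract al h)).
Qed.

Lemma lact_memv h x y v : v \in arrow_span k Q x y ->
  lact T h v \in arrow_span k Q (x * h^-1)%g (y * h^-1)%g.
Proof. by rewrite -lact_span => /memv_img->. Qed.

Lemma ract_linear h : linear (ract h).
Proof. exact: lin_ext_linear. Qed.

Lemma quiver_coactLE v h : coactL D v h = ract h v.
Proof.
rewrite /= /ract /lin_ext sum_ffunE; apply: eq_bigr => al _.
by rewrite ffunE sum_ltens_delta.
Qed.

Lemma quiver_coactRE v h : coactR D v h = lact T h v.
Proof.
rewrite [v in RHS]arrow_space_sum linear_sum /= /lin_ext sum_ffunE.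
by apply: eq_bigr => al _; rewrite ffunE linearZZ sum_ltens_delta.
Qed.

Lemma quiver_bimodule : is_bimodule (lmul D) (rmul D).
Proof.
have lmE := quiver_lmulE; have rmE := quiver_rmulE.
split; last by move=> a b v; apply/ffunP => al; rewrite !(lmE, rmE) mulrCA.
- split; first by move=> a; apply: lin_ext_linear.
  move=> v c a b; apply/ffunP => al.
  by rewrite ffunE [X in _ = X + _]ffunE !lmE !ffunE mulrDl -scalerAl.
- split; last by move=> a; apply: lin_ext_linear.
  move=> v c a b; apply/ffunP => al.
  by rewrite ffunE [X in _ = X + _]ffunE !rmE !ffunE mulrDl -scalerAl.
- split=> [v|a b v]; apply/ffunP => al; rewrite !lmE ffunE ?mul1r //.
  by rewrite mulrA.
- split=> [v|v a b]; apply/ffunP => al; rewrite !rmE ffunE ?mul1r //.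
  by rewrite [RHS]mulrCA mulrA.
Qed.

Lemma lmul_linear a : linear (lmul D a).
Proof. exact: lin_ext_linear. Qed.

Lemma rmul_linear a : linear ((rmul D)^~ a).
Proof. exact: lin_ext_linear. Qed.

Lemma quiver_differentialE a :
  differential D a = rmul D (quiver_theta T) a - lmul D a (quiver_theta T).
Proof. by []. Qed.

(** The Leibniz rule of a commutator: the two terms $a\theta b$ cancel. *)
Lemma quiver_gen_calculus : is_gen_calculus D.
Proof.
have [[_ lm_lin] [rm_lin _] [_ lmM] [_ rmM] lrm] := quiver_bimodule.
split=> [|c a b|a b]; first exact: quiver_bimodule.
  by rewrite !quiver_differentialE (rm_lin _ c) (lm_lin _ c) scalerBr addrACA -opprD.
rewrite !quiver_differentialE (linear_subf (rmul_linear b)) (linear_subf (lmul_linear a)).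
by rewrite rmM lmM lrm addrA subrK.
Qed.

(** Left multiplication by $h^{-1}$ permutes the vertices and keeps each step, so only the inner sum
    is reindexed. *)
Lemma ract_theta h : ract h (quiver_theta T) = quiver_theta T.
Proof.
rewrite /quiver_theta (linear_sumf (ract_linear h)); apply: eq_bigr => a _.
rewrite (linear_sumf (ract_linear h)).
rewrite [RHS](reindex_inj (mulgI h^-1)%g); apply: eq_bigr => x _.
exact: lin_ext_vec.
Qed.

(** The action permutes the Cayley arrows, because it is canonical on them. *)
Lemma lact_theta h : lact T h (quiver_theta T) = quiver_theta T.
Proof.
(* Both the vertex and the step move, so the double sum is first merged into one sum over Cayley
   arrows. *)
have thetaE : quiver_theta T = \sum_(al : arrow (cayley_digraph (steps T)))
    arrow_vec k (cayley_incl (@steps_mult _ _ T) al).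
  rewrite /quiver_theta exchange_big pair_big; apply: eq_bigr => al _.
  by rewrite /cvec -surjective_pairing.
rewrite {2}thetaE (reindex_inj (h := cayley_lact (@stepsJ _ _ T) h)); last first.
  apply: (can_inj (g := cayley_lact (@stepsJ _ _ T) h^-1%g)) => -[x [a Ca]].
  congr pair; first by rewrite /= invgK mulgKV.
  by apply: val_inj; rewrite /= invgK !mulgA mulVg mul1g mulgKV.
rewrite thetaE linear_sum; apply: eq_bigr => al _; exact: lact_cayley.
Qed.

(** Common argument for both coactions, with [m g] the motion of the vertices. Functions act on an
    arrow by their values at its endpoints, and invariance of $\theta$ carries the result over to
    $\mathrm{d}$. *)
Lemma quiver_equivariant (rho : gT -> kQ -> kQ) (tau : gT -> A -> A)
    (m : gT -> gT -> gT) :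
    (forall g, linear (rho g)) -> (forall g, rho g (quiver_theta T) = quiver_theta T) ->
    (forall g x y v, v \in arrow_span k Q x y ->
       rho g v \in arrow_span k Q (m g x) (m g y)) ->
    (forall g a x, tau g a (m g x) = a x) ->
  is_equivariant D rho tau.
Proof.
move=> rho_lin rho_theta rho_span tauE.
have rho_l g a v : rho g (lmul D a v) = lmul D (tau g a) (rho g v).
  move: v; apply: linear_eq_vec => [c u v|c u v|al].
  - by rewrite lmul_linear rho_lin.
  - by rewrite rho_lin lmul_linear.
  have al_span := arrow_vec_span al.
  rewrite (quiver_lmul_span _ al_span) (linear_scalef (rho_lin g)).
  by rewrite (quiver_lmul_span _ (rho_span g _ _ _ al_span)) tauE.
have rho_r g v a : rho g (rmul D v a) = rmul D (rho g v) (tau g a).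
  move: v; apply: linear_eq_vec => [c u v|c u v|al].
  - by rewrite rmul_linear rho_lin.
  - by rewrite rho_lin rmul_linear.
  have al_span := arrow_vec_span al.
  rewrite (quiver_rmul_span _ al_span) (linear_scalef (rho_lin g)).
  by rewrite (quiver_rmul_span _ (rho_span g _ _ _ al_span)) tauE.
split=> // g a.
by rewrite !quiver_differentialE (linear_subf (rho_lin g)) rho_l rho_r rho_theta.
Qed.

Lemma ract_comp g h v : ract h (ract g v) = ract (g * h)%g v.
Proof.
move: v; apply: linear_eq_vec => [c u v|c u v|al].
- by rewrite !ract_linear.
- exact: ract_linear.
by rewrite /ract !lin_ext_vec /hopf_ract /= invMg mulgA.
Qed.

Lemma ract1 v : ract 1%g v = v.
Proof.
rewrite [RHS]arrow_space_sum; apply: eq_bigr => -[x a] _.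
by rewrite /hopf_ract /= invg1 mul1g.
Qed.

Lemma quiver_bicovariant : is_bicovariant D.
Proof.
apply/bicovariantP; first exact: quiver_gen_calculus.
split; first split.
- by move=> h c u v; rewrite !quiver_coactLE ract_linear.
- by move=> v; rewrite quiver_coactLE ract1.
- by move=> v g h; rewrite !quiver_coactLE ract_comp.
- split=> [h c u v|v|v g h]; rewrite !quiver_coactRE ?linearP ?lact1 ?lactM //.
(* The coactions commute by the third condition on a triple. *)
- by move=> v g h; rewrite !(quiver_coactLE, quiver_coactRE); apply/esym/lact_ract.
- apply: (quiver_equivariant (m := fun g x => (g^-1 * x)%g)) => [g c u v|g|g x y v|g a x].
  + by rewrite !quiver_coactLE ract_linear.
  + by rewrite quiver_coactLE ract_theta.
  + by rewrite quiver_coactLE; apply: ract_span.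
  + by rewrite !ffunE mulKVg.
- apply: (quiver_equivariant (m := fun g x => (x * g^-1)%g)) => [g c u v|g|g x y v|g a x].
  + by rewrite !quiver_coactRE linearP.
  + by rewrite quiver_coactRE lact_theta.
  + by rewrite quiver_coactRE; apply: lact_memv.
  + by rewrite !ffunE mulgKV.
Qed.

End QuiverCalculus.

(** * Bases with a prescribed first vector *)

(** A nonzero [v] is completed by a basis of a complement of its line in [U]. The length [n] is kept
    apart from the dimension so that the tuple can be typed by the multiplicity of a conjugacy
    class. *)
Lemma basis_with_head (k : fieldType) (V : vectType k) (U : {vspace V}) (v : V) n :
    v \in U -> \dim U = n ->
  exists b : n.-tuple V, basis_of U b && ((v != 0) ==> (b`_0 == v)).
Proof.
move=> vU <-; have [->|v0] := eqVneq v 0; first by exists (vbasis U); rewrite vbasisP.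
pose s := v :: vbasis (U :\: <[v]>).
have Us : basis_of U s.
  rewrite -[U in basis_of U](addv_diff_cap U <[v]>) addvC (capv_idPr _) -?memvE //.
  rewrite -[s]cat1s cat_basis ?seq1_basis ?vbasisP //.
  by apply/directv_addP; rewrite capvC capv_diff.
have s_size : size s == \dim U.
  by rewrite -(span_basis Us) eq_sym; apply: basis_free Us.
by exists (Tuple s_size); rewrite Us eqxx implybT.
Qed.

(** * Translations, corners and innerness of a bicovariant calculus *)

Section Classification.
Variables (k : fieldType) (gT : finGroupType) (V : vectType k).
Variable D : calculus_data gT V.
Hypotheses (D_gen : is_gen_calculus D) (D_cov : is_bicovariant D).
Local Notation A := (fun_alg k gT).
Local Notation lm := (lmul D).
Local Notation rm := (rmul D).
Local Notation d := (differential D).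
Definition coactL_at (g : gT) (v : V) : V := coactL D v g.
Definition coactR_at (g : gT) (v : V) : V := coactR D v g.
Local Notation L := coactL_at.
Local Notation R := coactR_at.

Let lm_lin a : linear (lm a). Proof. by case: D_gen => [[[]]]. Qed.
Let lm_linA v : linear (lm^~ v : A -> V). Proof. by case: D_gen => [[[]]]. Qed.
Let rm_linA v : linear (rm v : A -> V). Proof. by case: D_gen => [[_ []]]. Qed.
Let rm_lin a : linear (rm^~ a). Proof. by case: D_gen => [[_ []]]. Qed.
Let lm1 v : lm 1 v = v. Proof. by case: D_gen => [[_ _ []]]. Qed.
Let lmM a b v : lm (a * b) v = lm a (lm b v). Proof. by case: D_gen => [[_ _ []]]. Qed.
Let rm1 v : rm v 1 = v. Proof. by case: D_gen => [[_ _ _ []]]. Qed.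
Let rmM v a b : rm v (a * b) = rm (rm v a) b. Proof. by case: D_gen => [[_ _ _ []]]. Qed.
Let lrm a v b : rm (lm a v) b = lm a (rm v b). Proof. by case: D_gen => [[]]. Qed.
Let d_lin : linear d. Proof. by case: D_gen. Qed.
Let dM a b : d (a * b) = rm (d a) b + lm a (d b). Proof. by case: D_gen. Qed.

Let D_coord := (bicovariantP D_gen).1 D_cov.
Let L_lin g : linear (L g).
Proof. by case: D_coord => [[L_lin _ _] *]; apply: L_lin. Qed.
Let L1 v : L 1%g v = v. Proof. by case: D_coord => [[_ L1 _] *]; apply: L1. Qed.
Let LM g h v : L h (L g v) = L (g * h)%g v.
Proof. by case: D_coord => [[_ _ LM] *]; apply: LM. Qed.
Let R_lin g : linear (R g).
Proof. by case: D_coord => [_ [R_lin _ _] *]; apply: R_lin. Qed.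
Let R1 v : R 1%g v = v. Proof. by case: D_coord => [_ [_ R1 _] *]; apply: R1. Qed.
Let RM g h v : R g (R h v) = R (g * h)%g v.
Proof. by case: D_coord => [_ [_ _ RM] *]; apply: RM. Qed.
Let LR g h v : L g (R h v) = R h (L g v).
Proof. by case: D_coord => [_ _ LR *]; apply: LR. Qed.
Let L_equiv : is_equivariant D L (fun g a => comult a g).
Proof. by case: D_coord. Qed.
Let R_equiv : is_equivariant D R (fun g a => rtranslate a g).
Proof. by case: D_coord. Qed.

Definition corner_proj (x y : gT) (v : V) : V := lm (delta k x) (rm v (delta k y)).
Local Notation proj := corner_proj.

Lemma corner_proj_linear x y : linear (proj x y).
Proof. by move=> c u v; rewrite /proj rm_lin lm_lin. Qed.

Definition corner (x y : gT) : {vspace V} := limg (linfun (proj x y)).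

Lemma lmul_corner_proj a x y v : lm a (proj x y v) = a x *: proj x y v.
Proof. by rewrite /proj -lmM delta_mul (linear_scalef (lm_linA _)). Qed.

Lemma rmul_corner_proj a x y v : rm (proj x y v) a = a y *: proj x y v.
Proof.
rewrite /proj lrm -rmM mul_delta (linear_scalef (rm_linA _)).
by rewrite (linear_scalef (lm_lin _)).
Qed.

Lemma corner_projK x y v : v \in corner x y -> proj x y v = v.
Proof.
case/memv_imgP => u _ ->; rewrite linfunE; last exact: corner_proj_linear.
by rewrite {1}/proj rmul_corner_proj (linear_scalef (lm_lin _)) lmul_corner_proj
  !ffunE !eqxx !scale1r.
Qed.

Lemma corner_proj_mem x y v : proj x y v \in corner x y.
Proof. by rewrite -(linfunE (corner_proj_linear x y)) memv_img ?memvf. Qed.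

Lemma lmul_corner a x y v : v \in corner x y -> lm a v = a x *: v.
Proof. by move/corner_projK <-; rewrite lmul_corner_proj. Qed.

Lemma rmul_corner a x y v : v \in corner x y -> rm v a = a y *: v.
Proof. by move/corner_projK <-; rewrite rmul_corner_proj. Qed.

(** Functions act on a corner by scalars, so [proj x y] multiplies by $\delta_x(z)\delta_y(t)$
    there. *)
Lemma corner_proj_corner x y z t v : v \in corner z t ->
  proj x y v = if (z == x) && (t == y) then v else 0.
Proof.
move=> v_zt; rewrite /proj (rmul_corner _ v_zt) (linear_scalef (lm_lin _)).
rewrite (lmul_corner _ v_zt) scalerA !ffunE.
by case: (z == x); case: (t == y); rewrite ?mulr1 ?mulr0 ?scale1r ?scale0r.
Qed.

(** The delta functions sum to $1$; inserting this on both sides gives the Peirce decomposition of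
    [V]. *)
Lemma corner_proj_sum v : v = \sum_x \sum_y proj x y v.
Proof.
transitivity (lm 1 (rm v 1)); first by rewrite lm1 rm1.
rewrite -{1}delta_sum1 (linear_sumf (lm_linA _)); apply: eq_bigr => x _.
by rewrite -delta_sum1 (linear_sumf (rm_linA _)) (linear_sumf (lm_lin _)).
Qed.

Lemma coactL_proj g x y v : L g (proj x y v) = proj (g^-1 * x)%g (g^-1 * y)%g (L g v).
Proof.
by have [Ll Lr _] := L_equiv; rewrite /proj [LHS]Ll [X in lm _ X]Lr !comult_delta.
Qed.

Lemma coactR_proj g x y v : R g (proj x y v) = proj (x * g^-1)%g (y * g^-1)%g (R g v).
Proof.
by have [Rl Rr _] := R_equiv; rewrite /proj [LHS]Rl [X in lm _ X]Rr !rtranslate_delta.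
Qed.

Lemma coactL_corner g x y v : v \in corner x y ->
  L g v \in corner (g^-1 * x)%g (g^-1 * y)%g.
Proof. by move/corner_projK <-; rewrite coactL_proj corner_proj_mem. Qed.

Lemma coactR_corner g x y v : v \in corner x y ->
  R g v \in corner (x * g^-1)%g (y * g^-1)%g.
Proof. by move/corner_projK <-; rewrite coactR_proj corner_proj_mem. Qed.

(* The sum of the [delta_x (d delta_y)] over [x != y]: the terms [x = y] vanish
   because [delta_x] is idempotent. *)
Definition inner_elt : V := \sum_y rm (d (delta k y)) (delta k y).
Local Notation theta := inner_elt.

(** Applying $\mathrm{d}$ to $a\delta_y=a(y)\delta_y$ and multiplying by $\delta_y$ on the right
    gives $(\mathrm{d}a)\delta_y=[(\mathrm{d}\delta_y)\delta_y,a]$; then sum over $y$. *)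
Lemma differential_inner : is_inner_by D theta.
Proof.
move=> a; rewrite /theta (linear_sumf (rm_lin _)) (linear_sumf (lm_lin _)) -sumrB.
rewrite -{1}[d a]rm1 -delta_sum1 (linear_sumf (rm_linA _)); apply: eq_bigr => y _.
rewrite -rmM mul_delta (linear_scalef (rm_linA _)).
have /= := congr1 (fun v => rm v (delta k y)) (dM a (delta k y)).
rewrite delta_mul (linear_scalef d_lin) (linear_scalef (rm_lin _)) => ->.
by rewrite (linear_addf (rm_lin _)) /= lrm addrK -rmM delta_mul ffunE eqxx scale1r.
Qed.

(** This keeps the identity out of the steps of the Cayley digraph. *)
Lemma inner_elt_diag x : proj x x theta = 0.
Proof.
(* The Leibniz rule for $\delta_x^2=\delta_x$, compressed to the corner $(x,x)$, reads $p=p+p$,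
   whence $p=0$. *)
have d_diag : proj x x (d (delta k x)) = 0.
  have := congr1 (proj x x) (dM (delta k x) (delta k x)).
  rewrite delta_mul ffunE eqxx scale1r (linear_addf (corner_proj_linear x x)).
  rewrite {2 3}/proj lrm -rmM -lmM delta_mul ffunE eqxx scale1r -/(proj x x _).
  by move/eqP; rewrite -subr_eq subrr eq_sym => /eqP.
rewrite /theta (linear_sumf (corner_proj_linear x x)) big1 // => y _.
rewrite /proj -rmM delta_mul ffunE; case: eqP => [<-|_].
  by rewrite scale1r -/(proj x x _).
by rewrite scale0r (linear_zerof (rm_linA _)) (linear_zerof (lm_lin _)).
Qed.

(** Translation permutes the delta functions compatibly with $\mathrm{d}$, hence permutes the
    summands of [theta]. *)
Lemma coactL_inner g : L g theta = theta.
Proof.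
have [_ Lr Ld] := L_equiv.
rewrite [RHS](reindex_inj (mulgI g^-1)%g) /theta (linear_sumf (L_lin g)).
by apply: eq_bigr => y _; rewrite [LHS]Lr [X in rm X]Ld comult_delta.
Qed.

Lemma coactR_inner g : R g theta = theta.
Proof.
have [_ Rr Rd] := R_equiv.
rewrite [RHS](reindex_inj (mulIg g^-1)%g) /theta (linear_sumf (R_lin g)).
by apply: eq_bigr => y _; rewrite [LHS]Rr [X in rm X]Rd rtranslate_delta.
Qed.

Lemma coactL_inj g : injective (L g).
Proof. by apply: (can_inj (g := L g^-1%g)) => v; rewrite LM mulgV L1. Qed.

Lemma coactR_inj g : injective (R g).
Proof. by apply: (can_inj (g := R g^-1%g)) => v; rewrite RM mulVg R1. Qed.

Lemma coactR_proj_inner g x y :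
  R g (proj x y theta) = proj (x * g^-1)%g (y * g^-1)%g theta.
Proof. by rewrite coactR_proj coactR_inner. Qed.

Lemma coactL_proj_inner g x y :
  L g (proj x y theta) = proj (g^-1 * x)%g (g^-1 * y)%g theta.
Proof. by rewrite coactL_proj coactL_inner. Qed.

(** * Multiplicities, Cayley steps and bases at the identity *)

(** [R h] followed by [L h^-1] embeds the corner $(1,a)$ into the corner $(1,hah^{-1})$: the left
    translation brings the source back to the identity. *)
Lemma dim_corner_conj_le h a :
  (\dim (corner 1 a) <= \dim (corner 1 (h * a * h^-1)))%N.
Proof.
pose K : 'End(V) := (linfun (L h^-1%g) \o linfun (R h))%VF.
have KE v : K v = L h^-1%g (R h v) by rewrite lfunE /= !linfunE.
have K_inj : lker K == 0%VS.
  by apply/lker0P => u v; rewrite !KE => /coactL_inj/coactR_inj.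
rewrite -(limg_dim_eq (f := K)); last by rewrite (eqP K_inj) capv0.
apply/dimvS/subvP => _ /memv_imgP[v v_a ->]; rewrite KE.
have := coactL_corner h^-1%g (coactR_corner h v_a).
by rewrite invgK mul1g mulgV mulgA.
Qed.

Lemma dim_corner_conj h a : \dim (corner 1 (h * a * h^-1)) = \dim (corner 1 a).
Proof.
apply/eqP; rewrite eqn_leq dim_corner_conj_le andbT.
(* The reverse inequality is the same embedding taken at $h^{-1}$ and $hah^{-1}$. *)
have := dim_corner_conj_le h^-1 (h * a * h^-1).
by rewrite invgK !mulgA mulVg mul1g mulgKV.
Qed.

(** A class is sampled at a chosen representative; invariance of the dimension under conjugation
    makes the choice harmless. *)
Definition corner_mult (C : {set gT}) : nat := \dim (corner 1 (repr C)).

Lemma corner_mult_class a : \dim (corner 1 a) = corner_mult (a ^: [set: gT])%g.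
Proof.
have /imsetP[h _ ha] := mem_repr a (class_refl [set: gT] a).
by rewrite /corner_mult ha conjgE -(dim_corner_conj h^-1) invgK mulgA.
Qed.

Definition corner_steps : {set gT} := [set a | proj 1 a theta != 0].

Lemma corner_steps1 : 1%g \notin corner_steps.
Proof. by rewrite inE inner_elt_diag eqxx. Qed.

(** The same two-sided translation is injective, and by invariance of [theta] it takes the component
    in the corner $(1,a)$ to the one in $(1,hah^{-1})$. *)
Lemma corner_stepsJ : conj_stable corner_steps.
Proof.
move=> h a; rewrite !inE; apply: contra => /eqP haV.
apply/eqP/(@coactR_inj h)/(@coactL_inj h^-1%g).
rewrite coactR_proj_inner coactL_proj_inner invgK mul1g mulgV mulgA haV.
by rewrite (linear_zerof (R_lin h)) (linear_zerof (L_lin _)).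
Qed.

Lemma corner_steps_mult a :
  a \in corner_steps -> (0 < corner_mult (a ^: [set: gT])%g)%N.
Proof.
rewrite inE -corner_mult_class lt0n; apply: contraNneq => /eqP.
by rewrite dimv_eq0 => /eqP a0; have := corner_proj_mem 1 a theta; rewrite a0 memv0.
Qed.

Lemma corner_basis_exists a :
  exists b : (corner_mult (a ^: [set: gT])%g).-tuple V,
    basis_of (corner 1 a) b && ((proj 1 a theta != 0) ==> (b`_0 == proj 1 a theta)).
Proof. exact: basis_with_head (corner_proj_mem 1 a theta) (corner_mult_class a). Qed.

Definition corner_basis a : (corner_mult (a ^: [set: gT])%g).-tuple V :=
  xchoose (corner_basis_exists a).

Lemma corner_basisP a : basis_of (corner 1 a) (corner_basis a).
Proof. by have /andP[] := xchooseP (corner_basis_exists a). Qed.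

(** Index $0$ is the first colour, so the first arrow of a Cayley step represents the component of
    [theta]. *)
Lemma corner_basis_head a :
  a \in corner_steps -> (corner_basis a)`_0 = proj 1 a theta.
Proof.
have /andP[_] := xchooseP (corner_basis_exists a).
by rewrite inE => /implyP b0 /b0/eqP b0E; apply: b0E.
Qed.

(** * Arrows as a basis of the calculus *)

Local Notation Q := (hopf_quiver corner_mult).
Local Notation kQ := (arrow_space k Q).

(* Left translation by [x] carries the basis of the corner [(1, a)] to a basis
   of the corner [(x, x a)]; this is what makes the right action canonical. *)
Definition arrow_image (al : arrow Q) : V :=
  L al.1^-1%g (corner_basis (tag al.2))`_(tagged al.2).

Lemma arrow_image_corner al : arrow_image al \in corner (source al) (target al).
Proof.
case: al => x [a i]; rewrite /arrow_image /=.
have b_a : (corner_basis a)`_i \in corner 1 a.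
  by rewrite (basis_mem (corner_basisP a)) // mem_nth // size_tuple.
by have := coactL_corner x^-1%g b_a; rewrite invgK mulg1.
Qed.

(** The functionals dual to the vectors [arrow_image]; projecting first keeps the argument of
    [coord] in the span of the basis. *)
Definition arrow_coord (al : arrow Q) (v : V) : k :=
  coord (corner_basis (tag al.2)) (tagged al.2)
    (L al.1 (proj (source al) (target al) v)).

Lemma arrow_coord_linear al : linear (arrow_coord al : V -> k^o).
Proof. by move=> c u v; rewrite /arrow_coord corner_proj_linear L_lin linearP. Qed.

Lemma arrow_coord_image al be : arrow_coord al (arrow_image be) = (be == al)%:R.
Proof.
rewrite /arrow_coord (corner_proj_corner _ _ (arrow_image_corner be)).
have [/andP[/eqP s_be /eqP t_be]|be_al] := ifP; last first.
  rewrite (linear_zerof (L_lin _)) linear0; case: (be =P al) be_al => [->|//].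
  by rewrite !eqxx.
(* Equal endpoints force equal steps, after which both colours lie in the same ordinal and freeness
   of the basis compares them. *)
case: al be s_be t_be => x [a i] [y [b j]] /= s_be; subst y => /mulgI t_be.
subst b; rewrite /arrow_image /= LM mulVg L1 coord_free; last first.
  exact: basis_free (corner_basisP a).
by rewrite xpair_eqE eqxx /= eq_Tagged.
Qed.

Definition arrow_map : 'Hom(kQ, V) := linfun (lin_ext arrow_image).
Local Notation psi := arrow_map.

Lemma arrow_mapE v : psi v = lin_ext arrow_image v.
Proof. by rewrite linfunE //; apply: lin_ext_linear. Qed.

Lemma arrow_map_vec al : psi (arrow_vec k al) = arrow_image al.
Proof. by rewrite arrow_mapE lin_ext_vec. Qed.

Lemma arrow_coord_map al v : arrow_coord al (psi v) = v al.
Proof.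
rewrite arrow_mapE (linear_sumf (arrow_coord_linear al)) (bigD1 al) //=.
rewrite (linear_scalef (arrow_coord_linear al)) arrow_coord_image eqxx.
rewrite big1 => [|be /negPf be_al]; first by rewrite addr0 [LHS]mulr1.
by rewrite (linear_scalef (arrow_coord_linear al)) arrow_coord_image be_al scaler0.
Qed.

Lemma arrow_map_inj : injective psi.
Proof.
by move=> u v uv; apply/ffunP => al; rewrite -!arrow_coord_map uv.
Qed.

(** Each corner component is moved to source the identity, expanded in the chosen basis there, and
    moved back. *)
Lemma arrow_map_surj u : u \in limg psi.
Proof.
rewrite [u]corner_proj_sum; apply: rpred_sum => x _; apply: rpred_sum => y _.
have := coactL_corner x (corner_proj_mem x y u); rewrite mulVg => u_xy.
have -> : proj x y u = L x^-1%g (L x (proj x y u)) by rewrite LM mulgV L1.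
rewrite (coord_basis (corner_basisP _) u_xy) (linear_sumf (L_lin _)).
apply: rpred_sum => i _; rewrite (linear_scalef (L_lin _)) rpredZ //.
apply/memv_imgP; exists (arrow_vec k (hopf_arrow x i)); first exact: memvf.
by rewrite arrow_map_vec.
Qed.

Lemma arrow_mapVK : cancel psi psi^-1%VF.
Proof. by move=> v; apply: lker0_lfunK; apply/lker0P/arrow_map_inj. Qed.

Lemma arrow_mapK : cancel psi^-1%VF psi.
Proof. by move=> u; apply/limg_lfunVK/arrow_map_surj. Qed.

(** With this, the vertex condition on the left action can be checked on corners of [V]. *)
Lemma arrow_map_span v x y : (psi v \in corner x y) = (v \in arrow_span k Q x y).
Proof.
apply/idP/arrow_spanP => [v_xy al|v_xy].
  rewrite -arrow_coord_map /arrow_coord (corner_proj_corner _ _ v_xy).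
  case: ifP => [/andP[/eqP-> /eqP->] //|_].
  by rewrite (linear_zerof (L_lin _)) linear0 eqxx.
rewrite arrow_mapE; apply: rpred_sum => al _.
have [->|/v_xy[<- <-]] := eqVneq (v al) 0; first by rewrite scale0r mem0v.
by rewrite rpredZ // arrow_image_corner.
Qed.

(** Translating by $x^{-1}$ and then by $h$ is translating by $(h^{-1}x)^{-1}$, the element attached
    to the moved arrow. *)
Lemma arrow_map_ract h v :
  psi (lin_ext (fun al : arrow Q => arrow_vec k (hopf_ract al h)) v) = L h (psi v).
Proof.
move: v; apply: linear_eq_vec => [c u v|c u v|[x a]].
- by rewrite lin_ext_linear linearP.
- by rewrite linearP L_lin.
by rewrite lin_ext_vec !arrow_map_vec /arrow_image LM /= invMg invgK.
Qed.

(** * The left action and the resulting triple *)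

(** Transport of [R h] along [psi], so that identities for the action can be checked in [V] by
    injectivity of [psi]. *)
Definition arrow_lact (h : gT) : 'End(kQ) := (psi^-1 \o (linfun (R h) \o psi))%VF.

Lemma arrow_map_lact h v : psi (arrow_lact h v) = R h (psi v).
Proof. by rewrite !lfunE /= arrow_mapK lfunE /= linfunE. Qed.

Lemma arrow_lact1 v : arrow_lact 1%g v = v.
Proof. by apply: arrow_map_inj; rewrite arrow_map_lact R1. Qed.

Lemma arrow_lactM g h v : arrow_lact (g * h)%g v = arrow_lact g (arrow_lact h v).
Proof. by apply: arrow_map_inj; rewrite !arrow_map_lact RM. Qed.

Lemma arrow_lact_memv h x y v : v \in arrow_span k Q x y ->
  arrow_lact h v \in arrow_span k Q (x * h^-1)%g (y * h^-1)%g.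
Proof. by rewrite -!arrow_map_span arrow_map_lact; apply: coactR_corner. Qed.

Lemma arrow_lact_span h x y :
  (arrow_lact h @: arrow_span k Q x y)%VS =
    arrow_span k Q (x * h^-1)%g (y * h^-1)%g.
Proof.
apply/vspaceP => v; apply/memv_imgP/idP => [[u u_xy ->]|/(arrow_lact_memv h^-1)].
  exact: arrow_lact_memv.
(* The preimage is supplied by the action of $h^{-1}$. *)
rewrite invgK !mulgKV => v_xy; exists (arrow_lact h^-1 v) => //.
by rewrite -arrow_lactM mulgV arrow_lact1.
Qed.

(** The first basis vector is the component of [theta] in the corner $(1,a)$, and left invariance
    moves it to $(x,xa)$. *)
Lemma arrow_map_cayley al :
  psi (arrow_vec k (cayley_incl corner_steps_mult al)) =
    proj (source al) (target al) theta.
Proof.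
case: al => x [a a_step]; rewrite arrow_map_vec /arrow_image /=.
by rewrite corner_basis_head // coactL_proj_inner invgK mulg1.
Qed.

Lemma arrow_lact_cayley h (al : arrow (cayley_digraph corner_steps)) :
  arrow_lact h (arrow_vec k (cayley_incl corner_steps_mult al)) =
    arrow_vec k (cayley_incl corner_steps_mult (cayley_lact corner_stepsJ h al)).
Proof.
apply: arrow_map_inj; rewrite arrow_map_lact !arrow_map_cayley.
by rewrite coactR_proj_inner source_cayley_lact target_cayley_lact.
Qed.

Lemma arrow_lact_ract g h v :
  arrow_lact g (lin_ext (fun al : arrow Q => arrow_vec k (hopf_ract al h)) v) =
    lin_ext (fun al : arrow Q => arrow_vec k (hopf_ract al h)) (arrow_lact g v).
Proof.
by apply: arrow_map_inj; rewrite arrow_map_lact !arrow_map_ract arrow_map_lact LR.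
Qed.

Definition calculus_triple : hopf_triple k gT :=
  HopfTriple corner_steps1 arrow_lact1 arrow_lactM
    arrow_lact_span arrow_lact_cayley arrow_lact_ract.
Local Notation T := calculus_triple.
Local Notation E := (quiver_calculus T).

(** * The isomorphism of calculi *)

Lemma arrow_map_lmul a v : psi (lmul E a v) = lm a (psi v).
Proof.
move: v; apply: linear_eq_vec => [c u v|c u v|al].
- by rewrite lmul_linear linearP.
- by rewrite linearP lm_lin.
rewrite (quiver_lmul_span (T := T) _ (arrow_vec_span al)) linearZZ /= arrow_map_vec.
by rewrite (lmul_corner _ (arrow_image_corner al)).
Qed.

Lemma arrow_map_rmul a v : psi (rmul E v a) = rm (psi v) a.
Proof.
move: v; apply: linear_eq_vec => [c u v|c u v|al].
- by rewrite rmul_linear linearP.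
- by rewrite linearP rm_lin.
rewrite (quiver_rmul_span (T := T) _ (arrow_vec_span al)) linearZZ /= arrow_map_vec.
by rewrite (rmul_corner _ (arrow_image_corner al)).
Qed.

(** Components of [theta] off the Cayley steps vanish, so the Cayley arrows exhaust its Peirce
    decomposition. *)
Lemma arrow_map_theta : psi (quiver_theta T) = theta.
Proof.
rewrite [RHS]corner_proj_sum /quiver_theta exchange_big linear_sum.
apply: eq_bigr => x _; rewrite linear_sum.
(* The target is written as $xa$, so that the inner sum runs over steps. *)
rewrite [RHS](reindex_inj (mulgI x)) [RHS](bigID (mem corner_steps)) /=.
rewrite [X in _ + X]big1 ?addr0 => [|a]; last first.
  rewrite inE negbK => /eqP a0; apply: (@coactL_inj x).
  by rewrite coactL_proj_inner mulVg mulKg a0 (linear_zerof (L_lin x)).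
by rewrite [RHS]big_sub; apply: eq_bigr => a _; apply: arrow_map_cayley.
Qed.

Lemma arrow_map_differential a : psi (differential E a) = d a.
Proof.
rewrite quiver_differentialE (linear_subf (f := psi) (linearP psi)).
rewrite arrow_map_lmul arrow_map_rmul arrow_map_theta.
by rewrite -differential_inner.
Qed.

(** The isomorphism is the inverse of [psi]; each compatibility is verified after applying [psi]. *)
Lemma calculus_triple_iso : calculus_iso D E.
Proof.
exists (psi^-1%VF : {linear V -> triple_space T}).
  by exists psi; [apply: arrow_mapK | apply: arrow_mapVK].
split=> [a v|v a|a|v|v].
- by apply: arrow_map_inj; rewrite arrow_map_lmul !arrow_mapK.
- by apply: arrow_map_inj; rewrite arrow_map_rmul !arrow_mapK.
- by apply: arrow_map_inj; rewrite arrow_map_differential arrow_mapK.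
- apply/ffunP => h; apply: arrow_map_inj.
  by rewrite quiver_coactLE arrow_map_ract ffunE !arrow_mapK.
- apply/ffunP => h; apply: arrow_map_inj.
  by rewrite quiver_coactRE arrow_map_lact ffunE !arrow_mapK.
Qed.

End Classification.

Theorem proposition6p5 (k : fieldType) (char_neq2 : 2%N \notin [pchar k])
    (gT : finGroupType) :
  (forall T : hopf_triple k gT,
     [/\ is_gen_bicovariant_calculus (quiver_calculus T),
         is_inner_by (quiver_calculus T)
           (\sum_(a : {a : gT | a \in steps T}) \sum_(x : gT) cvec T x a),
         (forall (f : fun_alg k gT) (x g : gT)
             (i : 'I_(mult T (g ^: [set: gT])%g)),
            rmul (quiver_calculus T) (avec T x i) f
              = f (x * g)%g *: avec T x i
            /\ lmul (quiver_calculus T) f (avec T x i) = f x *: avec T x i),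
         (forall (x g : gT) (i : 'I_(mult T (g ^: [set: gT])%g)),
            coactL (quiver_calculus T) (avec T x i)
              = \sum_(h : gT) ltens (delta k h) (avec T (h^-1 * x)%g i)) &
         (forall (x g : gT) (i : 'I_(mult T (g ^: [set: gT])%g)),
            coactR (quiver_calculus T) (avec T x i)
              = \sum_(h : gT) rtens (lact T h (avec T x i)) (delta k h))])
  /\
  (forall (V : vectType k) (D : calculus_data gT V),
     is_gen_bicovariant_calculus D ->
     exists T : hopf_triple k gT, calculus_iso D (quiver_calculus T)).
Proof.
split=> [T|V D [D_gen D_cov]]; last first.
  by exists (calculus_triple D_gen D_cov); apply: calculus_triple_iso.
split.
- split; [exact: quiver_gen_calculus | exact: quiver_bicovariant].
(* The differential is by definition the commutator with [quiver_theta], which unfolds to the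
   displayed sum. *)
- by [].
- move=> f x g i; have al_span := arrow_vec_span (T := T) (hopf_arrow x i).
  by split; [apply: (quiver_rmul_span _ al_span) | apply: (quiver_lmul_span _ al_span)].
- by move=> x g i; apply: lin_ext_vec.
- by move=> x g i; apply: lin_ext_vec.
Qed.
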